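(* Let $n\ge1$ and $N\geq 1$ be integers and let $\Gamma=\mathrm{NPB}(\{A_s\}_{s\in\Sigma_n})$ be a non-prefix binary graph with at least two vertices. Let $B_s:=\bigcup_{ss'\in\Sigma_n}A_{ss'}$ (where $s'$ ranges over all, possibly empty, binary sequences with $ss'\in\Sigma_n$) for all $s\in\Sigma_n$. Suppose $|B_{1^i0}|\leq|B_{1^i1}|$ for all $i=0,\ldots,n-1$. Put $X':=B_0\cup B_{10}\cup\cdots\cup B_{1^{n-1}0}$. Then \[\rho(N*\Gamma)=\max_{\substack{X'\subseteq X\subseteq V(\Gamma)\\ |X|\ge2}}\left\lceil\frac{N|E(\Gamma[X])|}{|X|-1}\right\rceil.\] In addition, \[\rho(N*\Gamma)=\left\lceil\frac{N|E(\Gamma)|}{|V(\Gamma)|-1}\right\rceil\] if $\Gamma$ is a complete multipartite graph.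
   Context: For a multigraph $G$ with at least two vertices, \[\rho(G):=\max_{\substack{X\subseteq V(G)\\|X|\geq2}}\left\lceil\frac{|E(G[X])|}{|X|-1}\right\rceil,\] which is the minimum number of forests needed to cover the edges of $G$ (Nash-Williams' theorem); $G[X]$ is the subgraph induced by $X$ and edges are counted with multiplicity. $N*\Gamma$ is the multigraph obtained from the simple graph $\Gamma$ by replacing every edge with $N$ parallel edges. Non-prefix binary graphs: for $n\geq1$ let $\Sigma_n$ be the set of all binary ($0/1$) sequences $s$ of length $l(s)$ with $1\leq l(s)\leq n$. A binary sequence $s'$ is a prefix of a binary sequence $s$ if $s=s's''$ (concatenation) for some binary sequence $s''$. Let $\{A_s\}_{s\in\Sigma_n}$ be a family of pairwise disjoint finite (possibly empty) sets such that $A_s=\varnothing$ if and only if $A_{s'}=\varnothing$ whenever $s,s'$ are the binary sequences of length $n$ with the same prefix of length $n-1$. The graph $\mathrm{NPB}(\{A_s\}_{s\in\Sigma_n})$ has vertex set $\bigcup_s A_s$ and edges $uv$ satisfying either (a) $u\in A_s$, $v\in A_{s'}$, $s\neq s'$ and $l(s)=l(s')$; or (b) $u\in A_s$, $v\in A_{s'}$, $l(s)<l(s')$ and $s$ is not a prefix of $s'$. The notation $1^i0$ (resp. $1^i1$) means the sequence of $i$ ones followed by $0$ (resp. $1$). *)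

(* Defs.v *)
From HB Require Import structures.
From mathcomp Require Import all_boot all_order all_algebra.

Set Implicit Arguments.
Unset Strict Implicit.
Unset Printing Implicit Defensive.

Definition ceil_div (a b : nat) : nat :=
  `|Num.ceil (a%:R / b%:R : rat)%R|%N.

Record sgraph (T : finType) := SGraph {
  svert : {set T};
  sedge : {set {set T}};
  sedgeP : forall e, e \in sedge -> (e \subset svert) && (#|e| == 2) }.

Definition sedges_in (T : finType) (G : sgraph T) (X : {set T}) :
  {set {set T}} := [set e in sedge G | e \subset X].

(* Loopless multigraphs: [medge] is an abstract type of edges, so that distinct
   edges may have the same set of ends. *)
Record mgraph (T : finType) := MGraph {
  mvert : {set T};
  medge : finType;
  mends : medge -> {set T};
  mendsP : forall e, (mends e \subset mvert) && (#|mends e| == 2) }.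

Definition medges_in (T : finType) (G : mgraph T) (X : {set T}) :
  {set medge G} := [set e | mends e \subset X].

Definition rho (T : finType) (G : mgraph T) : nat :=
  \max_(X : {set T} | (X \subset mvert G) && (2 <= #|X|))
     ceil_div #|medges_in G X| (#|X| - 1).

Definition mulgraph (T : finType) (N : nat) (G : sgraph T) : mgraph T :=
  @MGraph T (svert G) ({e : {set T} | e \in sedge G} * 'I_N)%type
    (fun p => val p.1) (fun p => sedgeP (valP p.1)).

Definition complete_multipartite (T : finType) (G : sgraph T) : Prop :=
  exists P : {set {set T}}, partition P (svert G) /\
    {in svert G &, forall u v,
       ([set u; v] \in sedge G) = (pblock P u != pblock P v)}.

Definition Sigma (n : nat) : {set n.-bseq bool} :=
  [set s : n.-bseq bool | 0 < size s].

(* Only the values of [npb_set] on [Sigma n] are relevant: every definition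
   below ignores the other ones. *)
Record npb_family (n : nat) (T : finType) := NPBFamily {
  npb_set :> seq bool -> {set T};
  npb_disjoint : {in Sigma n &, forall s t : n.-bseq bool,
    s != t -> [disjoint npb_set s & npb_set t]};
  npb_leaves : {in Sigma n &, forall s t : n.-bseq bool,
    size s = n -> size t = n -> take n.-1 s = take n.-1 t ->
    (npb_set s = set0 <-> npb_set t = set0)} }.

Section NPB.
Variables (n : nat) (T : finType) (A : npb_family n T).

Definition npb_vert : {set T} := \bigcup_(s in Sigma n) A s.

Definition npb_edge : {set {set T}} :=
  [set e : {set T} |
    [exists s : n.-bseq bool in Sigma n, exists t : n.-bseq bool in Sigma n,
     exists u in A s, exists v in A t,
       (e == [set u; v]) &&
       ((s != t) && (size s == size t) ||
        (size s < size t) && ~~ prefix s t)]].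

Lemma npb_edgeP e : e \in npb_edge -> (e \subset npb_vert) && (#|e| == 2).
Proof.
rewrite inE => /exists_inP[s sS] /exists_inP[t tS] /exists_inP[u uA].
case/exists_inP=> v vA /andP[/eqP-> st].
have nst : s != t.
  by case/orP: st => /andP[] // lt_st _; apply: contraTneq lt_st => ->; rewrite ltnn.
have nuv : u != v.
  apply: contraTneq uA => ->.
  by rewrite (disjointFl (npb_disjoint A sS tS nst)).
rewrite cards2 nuv eqxx andbT; apply/subsetP=> x.
by rewrite !inE => /orP[] /eqP->; apply/bigcupP; [exists s | exists t].
Qed.

Definition NPB : sgraph T := SGraph npb_edgeP.

Definition npb_B (s : seq bool) : {set T} :=
  \bigcup_(t in Sigma n | prefix s t) A t.

End NPB.

(* Main.v *)
Require Import Defs.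
From HB Require Import structures.
From mathcomp Require Import all_boot all_order all_algebra.
From mathcomp Require Import zify lra.

(** Take [X] attaining the maximum [r] of the density |E(G[Z])| / (|Z| - 1), and
    inclusionwise maximal among such sets. Then vertices in [X] have at least [r]
    neighbours in [X], vertices outside have fewer than [r], and counting edges
    gives 2r <= |X|. Two vertices of NPB are adjacent iff their labels are
    incomparable for the prefix order. Descending the spine of all-ones labels,
    let [C] be the union of the B_{1^j0} with j < i, already contained in [X].
    If r <= |C|, every vertex of B_{1^i0} is adjacent to all of [C], hence lies
    in [X]. Otherwise the vertices labelled 1^j with j <= i have degree at most
    |C| < r, so [X] lies in C u B_{1^i0} u B_{1^i1}, three pairwise completely
    joined sets, and 2r <= |X| puts B_{1^i0} in [X].
    For a complete multipartite graph, [X] is the whole vertex set. *)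

Section ExtremalSets.
Set Implicit Arguments.
Unset Strict Implicit.
Import Order.TTheory GRing.Theory Num.Theory.

(** * Ceilings, edge counts and degrees *)

Lemma leq_ceil_div (a b c d : nat) :
  (a%:R / b%:R <= c%:R / d%:R :> rat)%R -> ceil_div a b <= ceil_div c d.
Proof.
move=> le_ab_cd; rewrite -lez_nat /ceil_div.
have ge0 (x y : nat) : (0 <= Num.ceil (x%:R / y%:R : rat))%R.
  by rewrite -(ceil0 rat) le_ceil // divr_ge0.
by rewrite !gez0_abs ?ge0 // le_ceil.
Qed.

Lemma card_medges_in_mulgraph (T : finType) (G : sgraph T) (N : nat)
    (X : {set T}) :
  #|medges_in (mulgraph N G) X| = N * #|sedges_in G X|.
Proof.
have -> : medges_in (mulgraph N G) X =
    setX [set e : {e | e \in sedge G} | val e \subset X] [set: 'I_N].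
  by apply/setP=> -[e k]; rewrite !inE andbT.
rewrite cardsX cardsT card_ord mulnC; congr (_ * _).
rewrite -(card_imset _ val_inj); apply: eq_card => e.
apply/imsetP/idP => [[f] |].
  by rewrite !inE => sfX ->; rewrite (valP f).
by rewrite inE => /andP[eG eX]; exists (exist _ e eG); rewrite ?inE.
Qed.

(** Edges inside [X] are two-element subsets of [X]. This bounds the density from above and leaves
    no edge inside a singleton. *)
Lemma card_sedges_in_double (T : finType) (G : sgraph T) (X : {set T}) :
  2 * #|sedges_in G X| <= #|X| * #|X|.-1.
Proof.
have sub : sedges_in G X \subset [set e : {set T} | e \subset X & #|e| == 2].
  by apply/subsetP=> e; rewrite !inE => /andP[/sedgeP/andP[_ ->] ->].
have := subset_leq_card sub; rewrite cards_draws bin2 => le_e.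
by have := odd_double_half (#|X| * #|X|.-1); lia.
Qed.

Definition nbhd (T : finType) (G : sgraph T) (X : {set T}) (v : T) : {set T} :=
  [set u in X | [set u; v] \in sedge G].

Lemma sedge_irrefl (T : finType) (G : sgraph T) (v : T) :
  [set v; v] \notin sedge G.
Proof. by apply/negP=> /sedgeP/andP[_]; rewrite setUid cards1. Qed.

Lemma sedge2P (T : finType) (G : sgraph T) (e : {set T}) (v : T) :
  e \in sedge G -> v \in e -> exists u, u != v /\ e = [set u; v].
Proof.
move=> /sedgeP/andP[_ /cards2P[x [y [nxy ->]]]].
rewrite !inE => /orP[] /eqP->; last by exists x.
by exists y; rewrite eq_sym setUC.
Qed.

Lemma card_star (T : finType) (G : sgraph T) (X : {set T}) (v : T) :
  v \in X -> #|[set e in sedges_in G X | v \in e]| = #|nbhd G X v|.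
Proof.
move=> vX; have -> : [set e in sedges_in G X | v \in e] =
    [set [set u; v] | u in nbhd G X v].
  apply/setP=> e; rewrite !inE; apply/idP/imsetP.
    move=> /andP[/andP[eG eX] ve].
    have [u [nuv ee]] := sedge2P eG ve.
    exists u => //; rewrite inE -ee eG andbT.
    by apply: (subsetP eX); rewrite ee !inE eqxx.
  move=> [u]; rewrite inE => /andP[uX eG] ->.
  by rewrite eG subUset !sub1set uX vX !inE eqxx orbT.
apply: card_in_imset => u w; rewrite !inE => /andP[_ uG] /andP[_ wG] /setP/(_ u).
rewrite !inE eqxx /= => /esym/orP[/eqP // | /eqP uv].
by case/negP: (sedge_irrefl G v); rewrite -{1}uv.
Qed.

Lemma card_sedges_inD1 (T : finType) (G : sgraph T) (X : {set T}) (v : T) :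
  v \in X -> #|sedges_in G X| = #|sedges_in G (X :\ v)| + #|nbhd G X v|.
Proof.
move=> vX; rewrite -card_star // addnC.
rewrite -(cardsID [set e : {set T} | v \in e] (sedges_in G X)).
congr (_ + _); apply: eq_card => e; rewrite !inE ?subsetD1 //.
by rewrite andbC andbA.
Qed.

Lemma card_nbhd (T : finType) (G : sgraph T) (X : {set T}) (v : T) :
  v \in X -> #|nbhd G X v| <= #|X|.-1.
Proof.
move=> vX; rewrite (cardsD1 v X) vX /=; apply/subset_leq_card/subsetP => u.
rewrite !inE => /andP[-> uG]; rewrite andbT.
by apply: contraTneq uG => ->; apply: sedge_irrefl.
Qed.

(** * Densest vertex sets *)

(* [extremal G r X]: the maximum [r] of |E(G[Z])| / (|Z| - 1) is attained at
   [X], and [X] is inclusionwise maximal with this property. *)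
Definition extremal (T : finType) (G : sgraph T) (r : rat) (X : {set T}) :=
  [/\ X \subset svert G, 2 <= #|X|,
      (#|sedges_in G X|%:R = r * (#|X|%:R - 1))%R,
      forall Z : {set T}, Z \subset svert G -> 0 < #|Z| ->
        (#|sedges_in G Z|%:R <= r * (#|Z|%:R - 1))%R
    & forall v, v \in svert G -> v \notin X -> (#|nbhd G X v|%:R < r)%R].

(** Take [X] of largest cardinality among the densest sets: an outside vertex with at least [r]
    neighbours in [X] could be added without lowering the density. *)
Lemma extremal_exists (T : finType) (G : sgraph T) :
  2 <= #|svert G| -> exists r X, extremal G r X.
Proof.
move=> V2; pose P (X : {set T}) := (X \subset svert G) && (2 <= #|X|).
pose dens X : rat := (#|sedges_in G X|%:R / (#|X|%:R - 1))%R.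
have PV : P (svert G) by rewrite /P subxx.
have [X0 PX0 maxX0] := @arg_maxP _ _ _ _ P dens PV.
pose Q X := P X && (dens X == dens X0).
have QX0 : Q X0 by rewrite /Q PX0 eqxx.
have [X /andP[PX /eqP dX] maxX] := @arg_maxnP _ X0 Q (fun X => #|X|) QX0.
have densE (Z : {set T}) : 2 <= #|Z| ->
    (#|sedges_in G Z|%:R = dens Z * (#|Z|%:R - 1))%R.
  move=> Z2; rewrite /dens divfK // subr_eq0; apply/eqP=> Z1.
  by move: Z2; rewrite -(ler_nat rat) Z1; lra.
have [XV X2] := andP PX.
have bound (Z : {set T}) : Z \subset svert G -> 0 < #|Z| ->
    (#|sedges_in G Z|%:R <= dens X0 * (#|Z|%:R - 1))%R.
  move=> ZV; rewrite leq_eqVlt => /orP[/eqP Z1 | Z2].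
    (* A singleton has no edge, so both sides vanish. This case serves later to delete a vertex from
       a two-element set. *)
    have := card_sedges_in_double G Z; rewrite -Z1 /= muln0 leqn0 muln_eq0 /=.
    by move=> /eqP->; rewrite subrr mulr0.
  rewrite densE // ler_wpM2r //; last by apply: maxX0; rewrite /P ZV.
  by move: Z2; rewrite -(ler_nat rat); lra.
exists (dens X0), X; split=> //; first by rewrite densE // dX.
move=> v vV vX; rewrite ltNge; apply/negP=> le_r.
have PY : P (v |: X).
  by rewrite /P subUset sub1set vV XV cardsU1 vX; lia.
have [YV Y2] := andP PY.
suff /maxX : Q (v |: X) by rewrite cardsU1 vX; lia.
rewrite /Q PY /= eq_le; apply/andP; split; first exact: maxX0.
rewrite /dens ler_pdivlMr; last first.
  by rewrite subr_gt0 -(ltr_nat rat) in Y2 *.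
rewrite -/(dens _) (card_sedges_inD1 G (setU11 v X)) setU1K // natrD.
rewrite cardsU1 vX add1n -natr1 addrK densE // dX.
have : (#|nbhd G X v|%:R <= #|nbhd G (v |: X) v|%:R :> rat)%R.
  rewrite ler_nat; apply/subset_leq_card/subsetP=> u.
  by rewrite !inE => /andP[-> ->]; rewrite orbT.
by lra.
Qed.

(** * Degrees, size and absorption for a maximal densest set *)

Section Extremal.
Variables (T : finType) (G : sgraph T) (r : rat) (X : {set T}).
Hypothesis extX : extremal G r X.

(** Deleting [v] removes as many edges as its degree, while the upper bound for [X :\ v] drops by
    exactly [r]. *)
Lemma extremal_nbhd_ge (v : T) : v \in X -> (r <= #|nbhd G X v|%:R)%R.
Proof.
case: extX => XV X2 eX maxX _ vX.
have := maxX (X :\ v) (subset_trans (subsetDl _ _) XV).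
have := cardsD1 v X; rewrite vX add1n => cX.
have -> : 0 < #|X :\ v| by lia.
move=> /(_ isT); move: eX; rewrite (card_sedges_inD1 _ vX) cX natrD -natr1.
by lra.
Qed.

Lemma extremal_mem (v : T) :
  v \in svert G -> (r <= #|nbhd G X v|%:R)%R -> v \in X.
Proof.
case: extX => _ _ _ _ outX vV ler; apply: contraLR ler => vX.
by rewrite -ltNge outX.
Qed.

Lemma extremal_card_ge : (2 * r <= #|X|%:R)%R.
Proof.
case: extX => _ X2 eX _ _; have := card_sedges_in_double G X.
have X1 : (0 < #|X|%:R - 1 :> rat)%R.
  by move: X2; rewrite -(ler_nat rat); lra.
rewrite -(ler_nat rat) !natrM eX -subn1 natrB ?(leq_trans _ X2) //.
by rewrite mulrA ler_pM2r.
Qed.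

(* Either |C| + |X :&: L| or |C| + |X :&: R| is at least [r], as their sum is
   at least |X| >= 2r. In the former case all of [R] lies in [X], and
   |L| <= |R| then brings us to the latter case, where all of [L] lies in [X]. *)
Lemma extremal_sub_join (C L R : {set T}) :
    C \subset X -> L \subset svert G -> R \subset svert G ->
    X \subset C :|: L :|: R -> #|L| <= #|R| ->
    {in C & L, forall u v, [set u; v] \in sedge G} ->
    {in C & R, forall u v, [set u; v] \in sedge G} ->
    {in L & R, forall u v, [set u; v] \in sedge G} ->
  L \subset X.
Proof.
move=> CX LV RV sX LR eCL eCR eLR.
have absorb (P Q : {set T}) : Q \subset svert G ->
    {in C & P, forall u v, [set u; v] \in sedge G} ->
    {in C & Q, forall u v, [set u; v] \in sedge G} ->
    {in P & Q, forall u v, [set u; v] \in sedge G} ->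
    (r <= (#|C| + #|X :&: P|)%:R)%R -> Q \subset X.
  move=> QV eCP eCQ ePQ ler; apply/subsetP=> v vQ.
  apply: extremal_mem; first exact: (subsetP QV).
  apply: le_trans ler _; rewrite ler_nat.
  (* A common vertex would be adjacent to itself, as [C] and [P] are completely joined. *)
  have dCP : C :&: (X :&: P) = set0.
    apply/setP=> u; rewrite !inE; apply/and3P=> -[uC _ uP].
    by case/negP: (sedge_irrefl G u); apply: eCP.
  rewrite -cardsUI dCP cards0 addn0; apply/subset_leq_card/subsetP=> u.
  rewrite !inE => /orP[uC|/andP[-> uP]]; last exact: ePQ.
  by rewrite (subsetP CX) ?eCQ.
have X_le : #|X| <= #|C| + #|X :&: L| + #|X :&: R|.
  have : #|X| <= #|C :|: X :&: L :|: X :&: R|.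
    apply/subset_leq_card/subsetP=> v vX.
    by have := subsetP sX _ vX; rewrite !inE vX.
  move=> /leq_trans; apply; apply: leq_trans (leq_card_setU _ _).1 _.
  by rewrite leq_add2r (leq_card_setU _ _).1.
have eRL : {in R & L, forall u v, [set u; v] \in sedge G}.
  by move=> u v uR vL; rewrite setUC eLR.
case: (lerP r (#|C| + #|X :&: R|)%:R) => [|lt_r]; first exact: absorb.
have ler : (r <= (#|C| + #|X :&: L|)%:R)%R.
  have := extremal_card_ge; move: X_le lt_r; rewrite -(ler_nat rat) !natrD.
  have : (0 <= #|C|%:R :> rat)%R by [].
  by lra.
have RX := absorb _ _ RV eCL eCR eLR ler.
suff : (r <= (#|C| + #|X :&: R|)%:R)%R by rewrite leNgt lt_r.
apply: le_trans ler _; rewrite ler_nat leq_add2l (setIidPr RX).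
by apply: leq_trans LR; rewrite subset_leq_card ?subsetIr.
Qed.

(* For [v] outside [X], the part of [v] meets [X] in an independent set, so all
   edges of G[X] touch the neighbours of [v] in [X]; each neighbour has degree
   at most |X| - 1, whence [v] has at least [r] of them. *)
Lemma extremal_complete_multipartite :
  complete_multipartite G -> X = svert G.
Proof.
move=> [P [partP adjP]]; have [XV X2 eX _ _] := extX.
apply/eqP; rewrite eqEsubset XV; apply/subsetP=> v vV.
apply: extremal_mem => //.
have cover_edges : sedges_in G X \subset
    \bigcup_(u in nbhd G X v) [set e in sedges_in G X | u \in e].
  apply/subsetP=> e eGX; have := eGX; rewrite inE => /andP[eG eX'].
  have /andP[_ /cards2P[x [y [nxy ee]]]] := sedgeP eG; rewrite ee in eG eX' eGX *.
  move: eX'; rewrite subUset !sub1set => /andP[xX yX].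
  have xV := subsetP XV _ xX; have yV := subsetP XV _ yX.
  have exy := eG; rewrite adjP // in exy.
  case: (boolP ([set x; v] \in sedge G)) => [xv | nxv].
    by apply/bigcupP; exists x; rewrite inE ?xX // eGX !inE eqxx.
  (* Here [x] lies in the part of [v], so [y], being adjacent to [x], lies in another part. *)
  apply/bigcupP; exists y; last by rewrite inE eGX !inE eqxx orbT.
  rewrite inE yX /= adjP //; move: nxv; rewrite adjP // negbK => /eqP<-.
  by rewrite eq_sym.
have : #|sedges_in G X| <= #|nbhd G X v| * #|X|.-1.
  apply: leq_trans (subset_leq_card cover_edges) _.
  rewrite -sum_nat_const; elim/big_rec2: _ => [|u k U uN le_kU].
    by rewrite cards0.
  apply: leq_trans (leq_card_setU _ _).1 _; apply: leq_add => //.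
  by have := uN; rewrite inE => /andP[uX _]; rewrite card_star // card_nbhd.
have X1 : (0 < #|X|%:R - 1 :> rat)%R.
  by move: X2; rewrite -(ler_nat rat); lra.
rewrite -(ler_nat rat) natrM eX -subn1 natrB ?(leq_trans _ X2) //.
by rewrite ler_pM2r.
Qed.

(** The factor [N] scales all densities alike and the ceiling is monotone, so one densest set serves
    for every [N]. *)
Lemma rho_mulgraph_extremal (N : nat) :
  rho (mulgraph N G) = ceil_div (N * #|sedges_in G X|) (#|X| - 1).
Proof.
have [XV X2 eX maxX _] := extX.
rewrite /rho; under eq_bigr do rewrite card_medges_in_mulgraph.
apply/eqP; rewrite eqn_leq; apply/andP; split; last first.
  by rewrite (bigop.bigmax_sup X) ?XV.
have pos (Z : {set T}) : 2 <= #|Z| -> (0 < #|Z|%:R - 1 :> rat)%R.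
  by rewrite -(ler_nat rat); lra.
apply/bigmax_leqP=> Z /andP[ZV Z2]; apply: leq_ceil_div.
rewrite !natrM !natrB ?(ltnW Z2) ?(ltnW X2) // eX -!mulrA.
rewrite ler_wpM2l // divff ?gt_eqF ?pos // mulr1 ler_pdivrMr ?pos // maxX //.
exact: ltnW.
Qed.

End Extremal.

(** * The prefix order along the all-ones spine *)

(** The initial run of ones in [s] meets a zero before position [i], exhausts [s], or reaches length
    [i] with a letter to follow. *)
Lemma spine_prefix (i : nat) (s : seq bool) :
  [\/ exists2 k, k < i & prefix (rcons (nseq k true) false) s,
      s = nseq (size s) true /\ size s <= i
    | exists b, prefix (rcons (nseq i true) b) s].
Proof.
elim: i s => [|i IHi] [|b s].
- by constructor 2.
- by constructor 3; exists b; rewrite /= eqxx prefix0s.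
- by constructor 2.
case: b; last by constructor 1; exists 0; rewrite /= ?prefix0s.
have [[k ki ks] | [se si] | [b sb]] := IHi s.
- by constructor 1; exists k.+1.
- by constructor 2; rewrite /= -se.
- by constructor 3; exists b.
Qed.

Lemma prefix_nseq (i j : nat) : i <= j -> prefix (nseq i true) (nseq j true).
Proof. by elim: i j => [|i IHi] [|j] //= /IHi. Qed.

Lemma prefix_comparable (s t u : seq bool) :
  prefix s u -> prefix t u -> prefix s t || prefix t s.
Proof.
elim: u s t => [|x u IHu] [|y s] [|z t] //=.
case: eqP => //= -> psu; case: eqP => //= -> ptu; rewrite eqxx /=; exact: IHu.
Qed.

(** * Adjacency in NPB graphs and the descent along the spine *)

Section NPBGraph.
Variables (n : nat) (T : finType) (A : npb_family n T).

(** Comparing lengths decides which of the two kinds of edge occurs; together with its converse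
    below, this reduces adjacency to incomparability of labels. *)
Lemma npb_edge_incomparable (s t : n.-bseq bool) (u v : T) :
    s \in Sigma n -> t \in Sigma n -> u \in A s -> v \in A t ->
    ~~ prefix s t -> ~~ prefix t s ->
  [set u; v] \in npb_edge A.
Proof.
move=> sS tS us vt st ts; rewrite inE.
have nst : s != t by apply: contraNneq st => ->; apply: prefix_refl.
case: (ltngtP (size s) (size t)) => lt_st.
- apply/exists_inP; exists s => //; apply/exists_inP; exists t => //.
  apply/exists_inP; exists u => //; apply/exists_inP; exists v => //.
  by rewrite eqxx lt_st st orbT.
- apply/exists_inP; exists t => //; apply/exists_inP; exists s => //.
  apply/exists_inP; exists v => //; apply/exists_inP; exists u => //.
  by rewrite setUC eqxx lt_st ts orbT.
- apply/exists_inP; exists s => //; apply/exists_inP; exists t => //.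
  apply/exists_inP; exists u => //; apply/exists_inP; exists v => //.
  by rewrite eqxx lt_st eqxx nst.
Qed.

Lemma npb_set_inj (s t : n.-bseq bool) (v : T) :
  s \in Sigma n -> t \in Sigma n -> v \in A s -> v \in A t -> s = t.
Proof.
move=> sS tS vs vt; apply/eqP; apply: contraTT vs => nst.
by rewrite (disjointFl (npb_disjoint A sS tS nst)).
Qed.

Lemma npb_edge_incomparable_inv (t : n.-bseq bool) (u v : T) :
    t \in Sigma n -> v \in A t -> [set u; v] \in npb_edge A ->
  exists s : n.-bseq bool,
    [/\ s \in Sigma n, u \in A s, ~~ prefix s t & ~~ prefix t s].
Proof.
move=> tS vt e; have nuv : u != v.
  by have := npb_edgeP e; rewrite cards2; case: (u != v); rewrite ?andbF.
move: e; rewrite inE => /exists_inP[s1 s1S] /exists_inP[s2 s2S].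
case/exists_inP=> u1 us1 /exists_inP[u2 us2] /andP[/eqP euv cmp].
have [n12 n21] : ~~ prefix s1 s2 /\ ~~ prefix s2 s1.
  case/orP: cmp => /andP[].
    (* For words of equal length, being a prefix means being equal. *)
    move=> ns /eqP es; rewrite !prefixE es take_size -es take_size.
    have nv : val s1 != val s2 by rewrite val_eqE.
    by split; first rewrite eq_sym.
  move=> lt_s ->; split=> //; apply: contraL lt_s => /size_prefix.
  by rewrite -leqNgt.
have : v \in [set u1; u2] by rewrite -euv !inE eqxx orbT.
have : u \in [set u1; u2] by rewrite -euv !inE eqxx.
rewrite !inE => /orP[] /eqP uE /orP[] /eqP vE; subst.
all: try by rewrite eqxx in nuv.
- by have <- := npb_set_inj s2S tS us2 vt; exists s1.
- by have <- := npb_set_inj s1S tS us1 vt; exists s2.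
Qed.

Lemma npb_BP (s : seq bool) (v : T) :
  reflect (exists t : n.-bseq bool, [/\ t \in Sigma n, prefix s t & v \in A t])
          (v \in npb_B A s).
Proof.
apply: (iffP bigcupP) => [[t /andP[tS st] vt] | [t [tS st vt]]]; exists t => //.
by rewrite tS.
Qed.

Lemma npb_B_vert (s : seq bool) : npb_B A s \subset svert (NPB A).
Proof.
by apply/subsetP=> v /npb_BP[t [tS _ vt]]; apply/bigcupP; exists t.
Qed.

(** If extensions of [s] and [t] were comparable, both [s] and [t] would be prefixes of the longer
    one, hence comparable. *)
Lemma npb_B_edge (s t : seq bool) (u v : T) :
    ~~ prefix s t -> ~~ prefix t s -> u \in npb_B A s -> v \in npb_B A t ->
  [set u; v] \in npb_edge A.
Proof.
move=> st ts /npb_BP[s' [s'S ss us]] /npb_BP[t' [t'S tt vt]].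
apply: (npb_edge_incomparable s'S t'S) => //; apply/negP.
  move=> /(prefix_trans ss) st'; have := prefix_comparable st' tt.
  by rewrite (negPf st) (negPf ts).
move=> /(prefix_trans tt) ts'; have := prefix_comparable ss ts'.
by rewrite (negPf st) (negPf ts).
Qed.

(** The set [C] of the descent at stage [i]; at [i = n] it is the set [X'] of the theorem. *)
Definition npb_left (i : nat) : {set T} :=
  \bigcup_(j < i) npb_B A (rcons (nseq j true) false).

Lemma npb_left_edge (i : nat) (b : bool) (u v : T) :
    u \in npb_left i -> v \in npb_B A (rcons (nseq i true) b) ->
  [set u; v] \in npb_edge A.
Proof.
move=> /bigcupP[[j /= ji] _]; apply: npb_B_edge;
  elim: j i ji => [|j IHj] [|i] //=; exact: IHj.
Qed.

(** A label incomparable with [1^j] must have a zero among its first [j] letters. *)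
Lemma npb_nbhd_spine (i j : nat) (X : {set T}) (s : n.-bseq bool) (v : T) :
    s \in Sigma n -> v \in A s -> val s = nseq j true -> j <= i ->
  nbhd (NPB A) X v \subset npb_left i.
Proof.
move=> sS vs sE ji; apply/subsetP=> u; rewrite inE => /andP[_ /=].
move=> /(npb_edge_incomparable_inv sS vs)[t [tS ut]]; rewrite sE => ts st.
case: (spine_prefix j t) => [[k kj kt] | [tE tj] | [b bt]].
- apply/bigcupP; exists (Ordinal (leq_trans kj ji)) => //.
  by apply/npb_BP; exists t.
- by case/negP: ts; rewrite tE prefix_nseq.
- by case/negP: st; apply: prefix_trans bt; apply: prefix_rcons.
Qed.

Lemma extremal_sub_left (r : rat) (X : {set T}) :
    (forall i : nat, i < n ->
     #|npb_B A (rcons (nseq i true) false)|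
       <= #|npb_B A (rcons (nseq i true) true)|) ->
    extremal (NPB A) r X ->
  forall i, i <= n -> npb_left i \subset X.
Proof.
move=> leB extX; elim=> [|i IHi] lt_in; first by rewrite /npb_left big_ord0 sub0set.
have leftX := IHi (ltnW lt_in); have [XV _ _ _ _] := extX.
rewrite /npb_left big_ord_recr subUset [X in X && _]leftX /=.
case: (lerP r (#|npb_left i|%:R)%R) => [ler | ltr].
  apply/subsetP=> v vL; apply: (extremal_mem extX).
    exact: (subsetP (npb_B_vert _)) vL.
  apply: le_trans ler _; rewrite ler_nat.
  apply/subset_leq_card/subsetP=> u uC.
  by rewrite inE (subsetP leftX) //= (npb_left_edge uC vL).
apply: (extremal_sub_join (C := npb_left i) (R := npb_B A (rcons (nseq i true) true))
         extX) => //; try exact: npb_B_vert.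
- apply/subsetP=> v vX; have /bigcupP[s sS vs] := subsetP XV _ vX.
  case: (spine_prefix i s) => [[k ki ks] | [sE si] | [b bs]].
  + rewrite !inE; apply/orP; left; apply/orP; left.
    by apply/bigcupP; exists (Ordinal ki) => //; apply/npb_BP; exists s.
  + have := extremal_nbhd_ge extX vX.
    have := npb_nbhd_spine X sS vs sE si => /subset_leq_card.
    rewrite -(ler_nat rat) => le1 le2.
    by have := lt_le_trans ltr (le_trans le2 le1); rewrite ltxx.
  + have : v \in npb_B A (rcons (nseq i true) b) by apply/npb_BP; exists s.
    by rewrite !inE; case: b {bs} => ->; rewrite ?orbT.
- exact: leB.
- exact: npb_left_edge.
- exact: npb_left_edge.
(* The words [1^i0] and [1^i1] differ in their last letter. *)
- move=> u v; apply: npb_B_edge; by elim: i {lt_in IHi leftX ltr}.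
Qed.

End NPBGraph.
End ExtremalSets.

Theorem proposition3p8 (T : finType) (n N : nat) (A : npb_family n T) :
  1 <= n -> 1 <= N ->
  2 <= #|svert (NPB A)| ->
  (forall i : nat, i < n ->
     #|npb_B A (rcons (nseq i true) false)|
       <= #|npb_B A (rcons (nseq i true) true)|) ->
  let Gamma := NPB A in
  let X' : {set T} :=
    \bigcup_(i < n) npb_B A (rcons (nseq i true) false) in
  rho (mulgraph N Gamma) =
    \max_(X : {set T} |
            [&& X' \subset X, X \subset svert Gamma & 2 <= #|X|])
       ceil_div (N * #|sedges_in Gamma X|) (#|X| - 1)
  /\ (complete_multipartite Gamma ->
      rho (mulgraph N Gamma) =
        ceil_div (N * #|sedge Gamma|) (#|svert Gamma| - 1)).
Proof.
move=> _ _ V2 leB Gamma X'.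
have [r [X extX]] := extremal_exists V2.
have [XV X2 _ _ _] := extX; split.
  apply/eqP; rewrite eqn_leq; apply/andP; split.
    (* The extremal [X] contains [X'], so it competes in the restricted maximum. *)
    rewrite (rho_mulgraph_extremal extX) (bigop.bigmax_sup X) //.
    by rewrite XV X2 (extremal_sub_left leB extX (leqnn n)).
  apply/bigmax_leqP=> Z /and3P[_ ZV Z2].
  by rewrite /rho (bigop.bigmax_sup Z) ?ZV // card_medges_in_mulgraph.
move=> /(extremal_complete_multipartite extX) XE.
rewrite (rho_mulgraph_extremal extX) XE; congr (ceil_div (_ * _) _).
apply: eq_card => e; rewrite inE andb_idr //.
by move=> /sedgeP/andP[].
Qed.
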